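(* The group of piecewise projective homeomorphisms of $S^1$ admits no Polish group topology; that is, there is no separable, completely metrizable topology on this group for which multiplication and inversion are continuous.
   Context: Identify $S^1$ with the real projective line $\mathbb{R}P^1$, on which $\mathrm{PSL}(2,\mathbb{R})$ acts in the standard way by projective transformations. A homeomorphism $f$ of $S^1$ is piecewise projective if there is a partition of $S^1$ into finitely many intervals such that the restriction of $f$ to each interval agrees with the action of some element of $\mathrm{PSL}(2,\mathbb{R})$. The piecewise projective homeomorphisms form a group under composition. *)

(* Defs.v *)
From HB Require Import structures.
From mathcomp Require Import all_boot all_order all_algebra.
From mathcomp Require Import generic_quotient ring lra.
From mathcomp Require Import all_classical all_reals all_analysis.
Import Order.TTheory GRing.Theory Num.Theory.
Import numFieldNormedType.Exports.
Set Implicit Arguments.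
Unset Strict Implicit.
Unset Printing Implicit Defensive.
Local Open Scope classical_set_scope.
Local Open Scope ring_scope.
Local Open Scope quotient_scope.

Definition homeomorphism (S T : topologicalType) (f : S -> T) : Prop :=
  continuous f /\ exists2 g : T -> S, cancel f g /\ cancel g f & continuous g.

Definition separable (T : topologicalType) : Prop :=
  exists2 A : set T, countable A & dense A.

#[short(type="completeMetricType")]
HB.structure Definition CompleteMetric (R : numDomainType) :=
  {M of Complete M & Metric R M}.

(* [Complete] requires a point, so this excludes the empty space, which is
   irrelevant for groups. *)
Definition completely_metrizable (R : realType) (T : topologicalType) : Prop :=
  exists (M : completeMetricType R) (h : T -> M), homeomorphism h.

(* Openness of the empty set is [topo_bigU] over an empty index type. *)
Record topology_on (T : Type) := TopologyOn {
  topo_open : set_system T;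
  topo_openT : topo_open setT;
  topo_openI : setI_closed topo_open;
  topo_bigU : forall (I : Type) (f : I -> set T),
    (forall i, topo_open (f i)) -> topo_open (\bigcup_i f i) }.

Definition with_topology (T : Type) (tau : topology_on T) : Type := T.

HB.instance Definition _ (G : groupType) (tau : topology_on G) :=
  monoid.Group.on (with_topology tau).
HB.instance Definition _ (G : groupType) (tau : topology_on G) :=
  isOpenTopological.Build (with_topology tau)
    (topo_openT tau) (@topo_openI _ tau) (@topo_bigU _ tau).

Definition group_topology (G : groupType) (tau : topology_on G) : Prop :=
  let T := with_topology tau in
  continuous (fun p : T * T => (p.1 * p.2)%g) /\
  continuous (fun x : T => (x^-1)%g).

Definition polish_group_topology (R : realType) (G : groupType)
    (tau : topology_on G) : Prop :=
  [/\ group_topology tau,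
      separable (with_topology tau) &
      completely_metrizable R (with_topology tau)].

Section ProjectiveLine.
Variable R : realType.

Definition nzvec : set 'cV[R]_2 := [set v | v != 0].

Definition collinear : rel nzvec :=
  fun u v => `[< exists2 k : R, k != 0 & \val v = k *: \val u >].

Lemma collinear_refl : reflexive collinear.
Proof. by move=> u; apply/asboolP; exists 1; rewrite ?oner_neq0 ?scale1r. Qed.

Lemma collinear_sym : symmetric collinear.
Proof.
suff H u v : collinear u v -> collinear v u by move=> u v; apply/idP/idP; exact: H.
move=> /asboolP[k k0 e]; apply/asboolP; exists k^-1; first by rewrite invr_neq0.
by rewrite e scalerA mulVf// scale1r.
Qed.

Lemma collinear_trans : transitive collinear.
Proof.
move=> v u w /asboolP[k k0 e] /asboolP[l l0 e']; apply/asboolP.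
by exists (l * k); [rewrite mulf_neq0|rewrite e' e scalerA].
Qed.

Canonical collinear_equiv :=
  EquivRel collinear collinear_refl collinear_sym collinear_trans.

Definition RP1 : Type := quotient_topology {eq_quot collinear}.

HB.instance Definition _ := Topological.on RP1.
HB.instance Definition _ := Quotient.on RP1.

Definition line (v : nzvec) : RP1 := \pi_RP1 v.

(* PSL(2,R) is the quotient of SL(2,R) by {1, -1}; as A and -A act identically
   on lines, the transformations of RP1 induced by PSL(2,R) are exactly those
   induced by SL(2,R). *)
Definition SL2 : Type := {A : 'M[R]_2 | \det A == 1}.

Lemma SL2_unit (A : SL2) : \val A \in unitmx.
Proof. by rewrite unitmxE (eqP (valP A)) unitr1. Qed.

Lemma SL2_nz (A : SL2) (v : nzvec) : \val A *m \val v \in nzvec.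
Proof.
apply/mem_set => /=; apply/eqP => /(congr1 (mulmx (invmx (\val A)))).
rewrite mulKmx ?SL2_unit// mulmx0 => e.
by have /set_mem := valP v; rewrite /nzvec /= e eqxx.
Qed.

Definition SL2_nzvec (A : SL2) (v : nzvec) : nzvec := exist (fun x => x \in nzvec) _ (SL2_nz A v).

Definition proj_act (A : SL2) (p : RP1) : RP1 := line (SL2_nzvec A (repr p)).


(* The intervals of the circle are its connected subsets; those in a
   [partition] are nonempty. *)
Definition piecewise_projective (f : RP1 -> RP1) : Prop :=
  exists D : set (set RP1),
    [/\ finite_set D, partition D id [set: RP1] &
        forall I, D I -> connected I /\
          exists A : SL2, {in I, forall p, f p = proj_act A p}].

Lemma lineP (u v : nzvec) :
  line u = line v <-> exists2 k : R, k != 0 & \val v = k *: \val u.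
Proof.
split; first by move/eqquotP/asboolP.
by move=> h; apply/eqquotP/asboolP.
Qed.

Lemma line_repr (p : RP1) : line (repr p) = p.
Proof. exact: reprK. Qed.

Lemma proj_act_line (A : SL2) (v : nzvec) :
  proj_act A (line v) = line (SL2_nzvec A v).
Proof.
have /lineP[k k0 e] : line (repr (line v)) = line v by rewrite line_repr.
by apply/lineP; exists k => //=; rewrite e scalemxAr.
Qed.

Lemma SL2_1_subproof : \det (1%:M : 'M[R]_2) == 1.
Proof. by rewrite det1. Qed.
Definition SL2_1 : SL2 := exist (fun A => \det A == 1) _ SL2_1_subproof.

Lemma SL2_mul_subproof (A B : SL2) : \det (\val A *m \val B) == 1.
Proof. by rewrite det_mulmx (eqP (valP A)) (eqP (valP B)) mulr1. Qed.
Definition SL2_mul (A B : SL2) : SL2 := exist (fun A => \det A == 1) _ (SL2_mul_subproof A B).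

Lemma SL2_inv_subproof (A : SL2) : \det (invmx (\val A)) == 1.
Proof. by rewrite det_inv (eqP (valP A)) invr1. Qed.
Definition SL2_inv (A : SL2) : SL2 := exist (fun A => \det A == 1) _ (SL2_inv_subproof A).

Lemma proj_act1 p : proj_act SL2_1 p = p.
Proof.
rewrite -[p]line_repr proj_act_line; congr line; apply/val_inj => /=.
by rewrite mul1mx.
Qed.

Lemma proj_actM A B p : proj_act (SL2_mul A B) p = proj_act A (proj_act B p).
Proof.
rewrite -[p]line_repr !proj_act_line; congr line; apply/val_inj => /=.
by rewrite mulmxA.
Qed.

Lemma proj_actK A : cancel (proj_act A) (proj_act (SL2_inv A)).
Proof.
move=> p; rewrite -proj_actM -[RHS]proj_act1; congr proj_act.
by apply/val_inj => /=; rewrite mulVmx// SL2_unit.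
Qed.

Definition mkvec (a b : R) : 'cV[R]_2 := \col_i if i == 0 then a else b.

Lemma mkvecE (v : 'cV[R]_2) : v = mkvec (v 0 0) (v 1 0).
Proof.
apply/matrixP => i j; rewrite mxE ord1; case: ifP => [/eqP->//|].
by case: i => -[|[|]]//= i _; congr (v _ _); exact: val_inj.
Qed.

Lemma mkvec_scale k a b : k *: mkvec a b = mkvec (k * a) (k * b).
Proof. by apply/matrixP => i j; rewrite !mxE; case: ifP. Qed.

Lemma mkvec_inj a b c d : mkvec a b = mkvec c d -> a = c /\ b = d.
Proof. by move=> /matrixP e; move: (e 0 0) (e 1 0); rewrite !mxE. Qed.

Lemma affine_vec_nz t : mkvec t 1 \in nzvec.
Proof.
apply/mem_set; rewrite /nzvec /=; apply/eqP => /matrixP/(_ 1 0).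
by rewrite !mxE/= => /eqP; rewrite oner_eq0.
Qed.

Definition affine_vec t : nzvec := exist (fun x => x \in nzvec) _ (affine_vec_nz t).
Definition affine_chart (t : R) : RP1 := line (affine_vec t).

Lemma infty_vec_nz : mkvec 1 0 \in nzvec.
Proof.
apply/mem_set; rewrite /nzvec /=; apply/eqP => /matrixP/(_ 0 0).
by rewrite !mxE/= => /eqP; rewrite oner_eq0.
Qed.

Definition infty_vec : nzvec := exist (fun x => x \in nzvec) _ infty_vec_nz.
Definition infty : RP1 := line infty_vec.

Lemma RP1_cases p : p = infty \/ exists t, p = affine_chart t.
Proof.
rewrite -[p]line_repr; set v := repr p.
have v0 : \val v != 0 by have /set_mem := valP v.
have e := mkvecE (\val v).
have [b0|b0] := eqVneq (\val v 1 0) 0; [left|right].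
  have a0 : \val v 0 0 != 0.
    apply: contra v0 => /eqP a0; rewrite e b0 a0; apply/eqP/matrixP => i j.
    by rewrite !mxE; case: ifP.
  apply/esym/lineP; exists (\val v 0 0) => //=.
  by rewrite mkvec_scale mulr1 mulr0 -b0 -e.
exists (\val v 0 0 / \val v 1 0); apply/esym/lineP; exists (\val v 1 0) => //=.
by rewrite mkvec_scale mulr1 mulrC divfK.
Qed.

Lemma affine_chart_inj : injective affine_chart.
Proof.
move=> s t /lineP[k k0] /=; rewrite mkvec_scale => /mkvec_inj[->].
by rewrite mulr1 => <-; rewrite mul1r.
Qed.

Lemma affine_chart_neq_infty t : affine_chart t <> infty.
Proof.
move=> /lineP[k k0] /=; rewrite mkvec_scale => /mkvec_inj[_ /eqP].
by rewrite mulr1 eq_sym (negbTE k0).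
Qed.

Lemma affine_chart_continuous : continuous affine_chart.
Proof.
have h : continuous (affine_vec : R -> nzvec).
  apply: continuous_comp_initial => t.
  have -> : set_val \o affine_vec = (fun t : R => t *: mkvec 1 0 + mkvec 0 1).
    apply/funext => s /=; rewrite mkvec_scale; apply/matrixP => i j.
    by rewrite !mxE; case: ifP; rewrite ?mulr1 ?mulr0 ?addr0 ?add0r.
  by apply: cvgD; [apply: cvgZl; exact: cvg_id|exact: cvg_cst].
move=> t; apply: (@continuous_comp R nzvec RP1 affine_vec line); first exact: h.
exact: pi_continuous.
Qed.

Definition wedge2 (u v : 'cV[R]_2) : R := u 0 0 * v 1 0 - u 1 0 * v 0 0.
(* The sign of [arc_form a b] separates the two open arcs of RP1 whose end points
   are the lines of [a] and [b]. *)
Definition arc_form (a b v : 'cV[R]_2) : R := wedge2 a v * wedge2 b v.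
Definition arc (s : bool) (a b : 'cV[R]_2) : set RP1 :=
  [set p | 0 < (-1) ^+ s * arc_form a b (\val (repr p))].

Lemma arcE s a b v : arc s a b (line v) = (0 < (-1) ^+ s * arc_form a b (\val v)).
Proof.
have /lineP[k k0 e] : line v = line (repr (line v)) by rewrite line_repr.
rewrite /arc /= e.
have -> : arc_form a b (k *: \val v) = k ^+ 2 * arc_form a b (\val v).
  by rewrite /arc_form /wedge2 !mxE; ring.
by rewrite mulrCA pmulr_rgt0// exprn_even_gt0//= k0.
Qed.

Lemma arc_open s a b : open (arc s a b).
Proof.
have cx i : continuous (fun v : 'cV[R]_2 => v i 0 : R).
  by move=> v; exact: coord_continuous.
have cw u : continuous (wedge2 u).
  move=> v.
  exact: (cvgB (cvgM (cvg_cst (u 0 0)) (cx 1 v)) (cvgM (cvg_cst (u 1 0)) (cx 0 v))).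
have h : continuous (fun v : 'cV[R]_2 => (-1) ^+ s * arc_form a b v).
  move=> v; have := cvgM (cvg_cst ((-1) ^+ s : R)) (cvgM (cw a v) (cw b v)).
  exact.
rewrite /open /= /quotient_open.
have -> : \pi_RP1 @^-1` arc s a b =
    set_val @^-1` [set v | 0 < (-1) ^+ s * arc_form a b v].
  by apply/seteqP; split => v /=; rewrite -[\pi_RP1 v]/(line v) arcE set_valE.
exists [set v | 0 < (-1) ^+ s * arc_form a b v] => //.
by move/continuousP: h => /(_ [set x | 0 < x]); apply; exact: open_gt.
Qed.

Lemma connected_sep (T : topologicalType) (I U V : set T) x y :
  connected I -> open U -> open V -> U `&` V = set0 -> I `<=` U `|` V ->
  I x -> U x -> I y -> V y -> False.
Proof.
move=> cI oU oV UV IUV Ix Ux Iy Vy.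
have e : I `&` U = I.
  apply: cI; [by exists x|by exists U|exists (~` V); first exact: open_closedC].
  apply/seteqP; split => z [Iz Uz]; split => //.
    by move=> Vz; have : (U `&` V) z by []; rewrite UV.
  by case: (IUV z Iz).
have : (I `&` U) y by rewrite e.
by move=> [_ Uy]; have : (U `&` V) y by []; rewrite UV.
Qed.

Lemma connected_arc (I : set RP1) (a b u v : nzvec) :
  connected I -> ~ I (line a) -> ~ I (line b) -> I (line u) -> I (line v) ->
  0 < arc_form (\val a) (\val b) (\val u) ->
  arc_form (\val a) (\val b) (\val v) < 0 -> False.
Proof.
move=> cI Ia Ib Iu Iv pu pv.
apply: (connected_sep cI (arc_open false (\val a) (\val b))
  (arc_open true (\val a) (\val b)) _ _ Iu _ Iv).
- apply/seteqP; split => // p []; rewrite -[p]line_repr !arcE expr0 expr1 mul1r mulN1r.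
  by rewrite oppr_gt0 => /lt_trans h /h; rewrite ltxx.
- move=> p; rewrite -[p]line_repr; set w := repr p => Iw.
  rewrite /setU /= !arcE expr0 expr1 mul1r mulN1r oppr_gt0.
  have W (c : nzvec) : ~ I (line c) -> wedge2 (\val c) (\val w) != 0.
    move=> Ic; apply/eqP => cw; apply: Ic.
    suff -> : line c = line w by [].
    have := mkvecE (\val c); have := mkvecE (\val w); move: cw.
    have /set_mem : \val c \in nzvec by exact: valP.
    have /set_mem : \val w \in nzvec by exact: valP.
    rewrite /wedge2 /nzvec /=.
    set x := \val c 0 0; set y := \val c 1 0.
    set x' := \val w 0 0; set y' := \val w 1 0 => w0 c0 E ew ec.
    apply/lineP.
    have m0 : mkvec 0 0 = 0 :> 'cV[R]_2.
      by apply/matrixP => i j; rewrite !mxE; case: ifP.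
    have [x0|x0] := eqVneq x 0.
      have y0 : y != 0 by apply: contra c0 => /eqP y0; rewrite ec x0 y0 m0.
      have x'0 : x' = 0.
        by move: E; rewrite x0 mul0r sub0r => /eqP; rewrite oppr_eq0 mulf_eq0 (negbTE y0) => /eqP.
      have y'0 : y' != 0 by apply: contra w0 => /eqP y0'; rewrite ew x'0 y0' m0.
      exists (y' / y); first by rewrite mulf_neq0// invr_eq0.
      by rewrite /= ew ec mkvec_scale x'0 x0 mulr0 divfK.
    have E' : y' = x' / x * y.
      by move/eqP: E; rewrite subr_eq0 => /eqP E; apply: (mulfI x0); rewrite E; field.
    have x'0 : x' != 0.
      by apply: contra w0 => /eqP x'0; rewrite ew E' x'0 !mul0r m0.
    exists (x' / x); first by rewrite mulf_neq0// invr_eq0.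
    by rewrite /= ew ec mkvec_scale -E' divfK.
  have : arc_form (\val a) (\val b) (\val w) != 0 by rewrite mulf_neq0// W.
  by rewrite neq_lt => /orP[->|->]; [right|left].
- by rewrite arcE expr0 mul1r.
- by rewrite arcE expr1 mulN1r oppr_gt0.
Qed.

Lemma wedge2E a b c d : wedge2 (mkvec a b) (mkvec c d) = a * d - b * c.
Proof. by rewrite /wedge2 !mxE. Qed.

Lemma connected_affine (I : set RP1) :
  connected I -> ~ I infty -> is_interval [set t | I (affine_chart t)].
Proof.
move=> cI Ii x y Ix Iy z /andP[xz zy]; apply: contrapT => Iz.
have nz t : I (affine_chart t) -> t != z.
  by move=> It; apply/eqP => tz; apply: Iz; rewrite /= -tz.
apply: (@connected_arc I (affine_vec z) infty_vec (affine_vec x) (affine_vec y)) => //;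
  rewrite /arc_form /= !wedge2E.
- have : x < z by rewrite lt_neqAle nz. by move=> ?; lra.
- have : z < y by rewrite lt_neqAle eq_sym nz. by move=> ?; lra.
Qed.

Lemma connected_coaffine (I : set RP1) :
  connected I -> I infty -> is_interval [set t | ~ I (affine_chart t)].
Proof.
move=> cI Ii x y Ix Iy z /andP[xz zy] Iz.
have nz t : ~ I (affine_chart t) -> t != z.
  by move=> It; apply/eqP => tz; apply: It; rewrite tz.
have {}xz : x < z by rewrite lt_neqAle nz.
have {}zy : z < y by rewrite lt_neqAle eq_sym nz.
apply: (@connected_arc I (affine_vec x) (affine_vec y) infty_vec (affine_vec z)) => //;
  rewrite /arc_form /= !wedge2E.
- by lra.
- by nra.
Qed.

Lemma interval_endpoint (P : set R) x y : is_interval P -> P x -> ~ P y ->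
  exists2 e, e = sup P \/ e = inf P & (x <= e <= y) || (y <= e <= x).
Proof.
move=> iP Px Py.
have [xy|yx] := leP x y.
  have ub : ubound P y.
    move=> z Pz; rewrite leNgt; apply/negP => yz; apply: Py.
    by apply: (iP x z) => //; rewrite xy ltW.
  exists (sup P); first by left.
  have h1 : sup P <= y by apply: ge_sup => //; exists x.
  have h2 : x <= sup P by apply: ub_le_sup => //; exists y.
  by rewrite h1 h2.
have lb : lbound P y.
  move=> z Pz; rewrite leNgt; apply/negP => zy; apply: Py.
  by apply: (iP z x) => //; rewrite (ltW zy) ltW.
exists (inf P); first by right.
have h1 : y <= inf P by apply: lb_le_inf => //; exists x.
have h2 : inf P <= x by apply: ge_inf => //; exists y.
by rewrite h1 h2 orbT.
Qed.

Definition cuts (I : set RP1) : set RP1 :=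
  let P := [set t | I (affine_chart t)] in
  [set infty; affine_chart (sup P); affine_chart (inf P);
     affine_chart (sup (~` P)); affine_chart (inf (~` P))].

Lemma cuts_finite I : finite_set (cuts I).
Proof. by rewrite /cuts !finite_setU; do !split; exact: finite_set1. Qed.

Lemma cutsP (I C : set RP1) p : connected I -> connected C ->
  C `&` cuts I = set0 -> C p -> I p -> C `<=` I.
Proof.
move=> cI cC CI Cp Ip q Cq; apply: contrapT => Iq.
have nC r : cuts I r -> ~ C r.
  by move=> Ir Cr; have : (C `&` cuts I) r by []; rewrite CI.
have Ci : ~ C infty by apply: nC; do 4 left.
have [pi|[x px]] := RP1_cases p; first by apply: Ci; rewrite -pi.
have [qi|[y qy]] := RP1_cases q; first by apply: Ci; rewrite -qi.
subst p q.
have iC := connected_affine cC Ci.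
have C_between e : (x <= e <= y) || (y <= e <= x) -> C (affine_chart e).
  by move=> /orP[] h; [apply: (iC x y)|apply: (iC y x)].
have [Ii|Ii] := pselect (I infty).
  have := @interval_endpoint _ y x (connected_coaffine cI Ii) Iq (fun h => h Ip).
  move=> [e ee h]; have : C (affine_chart e) by apply: C_between; rewrite orbC.
  by apply: nC; case: ee => ->; [left; right|right].
have := @interval_endpoint _ x y (connected_affine cI Ii) Ip Iq.
move=> [e ee h]; have : C (affine_chart e) by apply: C_between.
by apply: nC; case: ee => ->; [do 3 left; right|do 2 left; right].
Qed.

Lemma proj_act_trans (p q : RP1) : exists A : SL2, proj_act A p = q.
Proof.
suff H r : exists A : SL2, proj_act A infty = r.
  have [[A Ap] [B Bq]] := (H p, H q).
  by exists (SL2_mul B (SL2_inv A)); rewrite proj_actM -Ap proj_actK.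
have [->|[t ->]] := RP1_cases r; first by exists SL2_1; rewrite proj_act1.
pose M : 'M[R]_2 := \matrix_(i, j)
  if i == 0 then (if j == 0 then t else -1) else (if j == 0 then 1 else 0).
have dM : \det M == 1.
  rewrite (expand_det_row _ 0) !big_ord_recl big_ord0 /cofactor !det_mx11 !mxE/=.
  by apply/eqP; rewrite /bump /= expr0 expr1; ring.
exists (exist (fun A : 'M[R]_2 => \det A == 1) M dM); 
rewrite proj_act_line; congr line; apply/val_inj => /=.
apply/matrixP => i j; rewrite !mxE !big_ord_recl big_ord0 !mxE /=.
by case: ifP => _; ring.
Qed.

Definition interval_partition (s : seq R) (D : set (set R)) :=
  [/\ finite_set D, partition D id [set: R] & forall A, D A -> is_interval A /\
     ((exists a, A = [set a]) \/ (forall a, a \in s -> ~ A a))].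

Lemma interval_partition_exists s : exists D, interval_partition s D.
Proof.
elim: s => [|a s [D [fD [cD tD nD] iD]]].
  exists [set setT]; split; first exact: finite_set1.
    split; first by rewrite /cover bigcup_set1.
      by move=> A B /= -> ->.
    by move=> A /= ->; exists 0.
  by move=> A /= ->; split; [move=> ?|right].
pose J := [set [set t : R | t < a]; [set a]; [set t | a < t]].
exists ([set A `&` B | A in D & B in J] `&` [set C | C !=set0]); split.
- apply: finite_setIl; apply: finite_image2 => //.
  by rewrite !finite_setU; do !split; exact: finite_set1.
- split.
  + apply/seteqP; split => // t _.
    have : cover D id t by rewrite cD.
    move=> [A DA At].
    have [B JB Bt] : exists2 B, J B & B t.
      have [ta|ta|->] := ltgtP t a.
      * by exists [set t : R | t < a] => //; do 2 left.
      * by exists [set t : R | a < t] => //; right.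
      * by exists [set a] => //; left; right.
    exists (A `&` B) => //; split; last by exists t.
    by exists A => //; exists B.
  + move=> C C' [[A DA [B JB <-]] _] [[A' DA' [B' JB' <-]] _] [t [[/= At Bt] [A't B't]]].
    have -> : A = A' by apply: tD => //; exists t.
    congr (_ `&` _).
    case: JB => [[|]|] /= E; case: JB' => [[|]|] /= E'; move: Bt B't;
      rewrite E E' //= => h h'; exfalso; move: h h' => /=; lra.
  + by move=> C [].
- move=> C [[A DA [B JB <-]] _]; have [iA sA] := iD _ DA; split.
    have iB : is_interval B.
      by case: JB => [[|]|] /= -> x y /= hx hy z /andP[? ?]; rewrite /= in hx hy *; lra.
    move=> x y [Ax Bx] [Ay By] z xzy; split; [exact: iA xzy|exact: iB xzy].
  have [[b ->]|h] := sA.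
    have [Bb|Bb] := pselect (B b).
      by left; exists b; apply/seteqP; split => [t []//|t /= ->].
    by right => c _ [/= -> ].
  case: JB => [[|]|] /= E.
  + right => c; rewrite inE => /orP[/eqP->|/h nA [Ac _]//].
    by rewrite E => -[_ /=]; rewrite ltxx.
  + have [Aa|Aa] := pselect (A a).
      left; exists a; rewrite E; apply/seteqP; split => [t []//|t /= ->//].
    by right => c _ [Ac]; rewrite E /= => ca; apply: Aa; rewrite -ca.
  + right => c; rewrite inE => /orP[/eqP->|/h nA [Ac _]//].
    by rewrite E => -[_ /=]; rewrite ltxx.
Qed.

(* Unlike [piecewise_projective], this form is visibly stable under composition:
   two intervals of the circle may have a disconnected intersection. *)
Lemma piecewise_projectiveP f : piecewise_projective f <->
  exists2 F : set RP1, finite_set F & forall C, connected C -> C `&` F = set0 ->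
    exists A : SL2, {in C, forall p, f p = proj_act A p}.
Proof.
split=> [[D [fD [cD tD nD] hD]]|[F fF hF]].
  exists (\bigcup_(I in D) cuts I).
    by apply: bigcup_finite => // I _; exact: cuts_finite.
  move=> C cC CF; have [C0|/set0P[p Cp]] := eqVneq C set0.
    by exists SL2_1 => p; rewrite C0 inE.
  have : cover D id p by rewrite cD.
  move=> [I DI Ip]; have [cI [A hA]] := hD _ DI.
  exists A => q /set_mem Cq; apply: hA; apply/mem_set.
  apply: (@cutsP I C p) => //; apply/seteqP; split => // r [Cr Ir].
  by rewrite -CF; split => //; exists I.
have /finite_seqP[s sE] : finite_set (affine_chart @^-1` F).
  by apply: finite_preimage => // x y _ _; exact: affine_chart_inj.
have [D [fD [cD tD nD] iD]] := interval_partition_exists s.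
exists ([set affine_chart @` A | A in D] `|` [set [set infty]]); split.
- by rewrite finite_setU; split; [exact: finite_image|exact: finite_set1].
- split.
  + apply/seteqP; split => // p _.
    have [->|[t ->]] := RP1_cases p; first by exists [set infty]; [right|].
    have : cover D id t by rewrite cD.
    move=> [A DA At]; exists (affine_chart @` A); last by exists t.
    by left; exists A.
  + move=> _ _ [[A DA <-]|->] [[B DB <-]|->] [p []] //=.
    * move=> [t At <-] [t' Bt' /affine_chart_inj e].
      by rewrite (tD A B)//; exists t; split => //; rewrite -e.
    * by move=> [t At <-] /affine_chart_neq_infty.
    * by move=> -> [t At /affine_chart_neq_infty].
  + move=> _ [[A DA <-]|->]; last by exists infty.
    by have [t At] := nD _ DA; exists (affine_chart t); exists t.
- have pt p : exists A : SL2, {in [set p], forall q, f q = proj_act A q}.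
    have [A Ap] := proj_act_trans p (f p).
    by exists A => q /set_mem /= ->.
  move=> _ [[A DA <-]|->]; last by split; [exact: connected1|exact: pt].
  have [iA sA] := iD _ DA.
  have cA : connected (affine_chart @` A).
    apply: connected_continuous_connected; first exact/connected_intervalP.
    by apply: continuous_subspaceT; exact: affine_chart_continuous.
  split=> //; case: sA => [[a ->]|h]; first by rewrite image_set1; exact: pt.
  apply: hF => //; apply/seteqP; split => // p [[t At <-] Ft].
  apply: (h t) => //.
  by have : [set` s] t by rewrite -sE.
Qed.

Record PPHomeo := MkPPHomeo {
  pphomeo_fun :> RP1 -> RP1;
  pphomeo_homeo : homeomorphism pphomeo_fun;
  pphomeo_pp : piecewise_projective pphomeo_fun }.

Lemma PPHomeo_eq (f g : PPHomeo) : (forall p, f p = g p) -> f = g.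
Proof.
case: f g => [f hf pf] [g hg pg] /= /funext e; subst g.
by congr MkPPHomeo; exact: Prop_irrelevance.
Qed.

Lemma pp_id_homeo : homeomorphism (@id RP1).
Proof. by split; [move=> p; exact: cvg_id|exists id => // p; exact: cvg_id]. Qed.

Lemma pp_id_pp : piecewise_projective (@id RP1).
Proof.
apply/piecewise_projectiveP; exists set0; first exact: finite_set0.
by move=> C _ _; exists SL2_1 => p _; rewrite proj_act1.
Qed.

Lemma pp_comp_homeo (f g : PPHomeo) : homeomorphism (f \o g).
Proof.
have [cf [f' [fK f'K] cf']] := pphomeo_homeo f.
have [cg [g' [gK g'K] cg']] := pphomeo_homeo g.
split; first by move=> p; apply: continuous_comp; [exact: cg|exact: cf].
exists (g' \o f'); first by split; exact: can_comp.
by move=> p; apply: continuous_comp; [exact: cf'|exact: cg'].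
Qed.

Lemma pp_comp_pp (f g : PPHomeo) : piecewise_projective (f \o g).
Proof.
have [cg [g' [gK g'K] cg']] := pphomeo_homeo g.
have /piecewise_projectiveP[F fF hF] := pphomeo_pp f.
have /piecewise_projectiveP[G fG hG] := pphomeo_pp g.
apply/piecewise_projectiveP; exists (G `|` g @^-1` F).
  rewrite finite_setU; split => //.
  by apply: finite_preimage => // x y _ _; exact: (can_inj gK).
move=> C cC CGF.
have [B hB] : exists B : SL2, {in C, forall p, g p = proj_act B p}.
  apply: hG => //; apply/seteqP; split => // p [Cp Gp].
  by rewrite -CGF; split => //; left.
have [A hA] : exists A : SL2, {in g @` C, forall p, f p = proj_act A p}.
  apply: hF.
    by apply: connected_continuous_connected => //; exact: continuous_subspaceT.
  apply/seteqP; split => // _ [[p Cp <-] Fp].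
  have : (C `&` (G `|` g @^-1` F)) p by split => //; right.
  by rewrite CGF.
exists (SL2_mul A B) => p Cp /=; rewrite proj_actM -hB// hA//.
by apply/mem_set; exists p => //; exact/set_mem.
Qed.

Definition pphomeo_one : PPHomeo := MkPPHomeo pp_id_homeo pp_id_pp.
Definition pphomeo_mul (f g : PPHomeo) : PPHomeo :=
  MkPPHomeo (pp_comp_homeo f g) (pp_comp_pp f g).

Lemma pphomeo_inv_exists (f : PPHomeo) :
  exists g : PPHomeo, cancel f g /\ cancel g f.
Proof.
have [cf [g [fK gK] cg]] := pphomeo_homeo f.
have /piecewise_projectiveP[F fF hF] := pphomeo_pp f.
have hg : homeomorphism g by split => //; exists f.
suff pg : piecewise_projective g by exists (MkPPHomeo hg pg).
apply/piecewise_projectiveP; exists (f @` F); first exact: finite_image.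
move=> C cC CF.
have [A hA] : exists A : SL2, {in g @` C, forall p, f p = proj_act A p}.
  apply: hF.
    by apply: connected_continuous_connected => //; exact: continuous_subspaceT.
  apply/seteqP; split => // _ [[p Cp <-] Fp].
  have : (C `&` f @` F) p by split => //; exists (g p).
  by rewrite CF.
exists (SL2_inv A) => p Cp.
rewrite -[in RHS](gK p) hA ?proj_actK//.
by apply/mem_set; exists p => //; exact/set_mem.
Qed.

Definition pphomeo_inv (f : PPHomeo) : PPHomeo :=
  projT1 (cid (pphomeo_inv_exists f)).

Lemma pphomeo_funK (f : PPHomeo) : cancel f (pphomeo_inv f).
Proof. by rewrite /pphomeo_inv; case: cid => g []. Qed.

Lemma pphomeo_invK (f : PPHomeo) : cancel (pphomeo_inv f) f.
Proof. by rewrite /pphomeo_inv; case: cid => g []. Qed.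

HB.instance Definition _ := gen_eqMixin PPHomeo.
HB.instance Definition _ := gen_choiceMixin PPHomeo.

Lemma pphomeo_mulA : associative pphomeo_mul.
Proof. by move=> f g h; exact: PPHomeo_eq. Qed.
Lemma pphomeo_mul1g : left_id pphomeo_one pphomeo_mul.
Proof. by move=> f; exact: PPHomeo_eq. Qed.
Lemma pphomeo_mulg1 : right_id pphomeo_one pphomeo_mul.
Proof. by move=> f; exact: PPHomeo_eq. Qed.
Lemma pphomeo_mulVg : left_inverse pphomeo_one pphomeo_inv pphomeo_mul.
Proof. by move=> f; apply: PPHomeo_eq => p /=; exact: pphomeo_funK. Qed.
Lemma pphomeo_mulgV : right_inverse pphomeo_one pphomeo_inv pphomeo_mul.
Proof. by move=> f; apply: PPHomeo_eq => p /=; exact: pphomeo_invK. Qed.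

HB.instance Definition _ := isGroup.Build PPHomeo
  pphomeo_mulA pphomeo_mul1g pphomeo_mulg1 pphomeo_mulVg pphomeo_mulgV.

End ProjectiveLine.

(* Main.v *)
Require Import Defs.
From mathcomp Require Import all_boot all_order all_algebra.
From mathcomp Require Import all_classical all_reals all_analysis.
From mathcomp Require Import ring lra.
Import Order.TTheory GRing.Theory Num.Theory.
Import numFieldNormedType.Exports.
Set Implicit Arguments.
Unset Strict Implicit.
Unset Printing Implicit Defensive.
Local Open Scope classical_set_scope.
Local Open Scope ring_scope.

(** An infinite product with disjoint supports contradicts the finiteness of the
    number of pieces.

    Suppose that the group [G] of piecewise projective homeomorphisms is Polish.
    Take disjoint arcs [J_0, J_1, ...] of the circle.  For each [n] there are
    uncountably many elements of [G] supported in [J_n]: hyperbolic elements of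
    SL(2,R) fixing the two ends of a subarc, cut off outside of it
    ([arc_bump_family]).  As [G] is separable, two of them are arbitrarily close,
    so that there are elements of [G] other than 1, supported in [J_n] and
    arbitrarily close to 1 ([close_pair]).  Choosing [h_n] among them inductively,
    close enough to 1, one makes the products [h_0 h_1 ... h_n] converge to some
    [l] in [G], by completeness ([convergent_product]).

    It remains to see that [l] coincides with [h_n] on [J_n], although nothing
    relates the topology of [G] to that of the circle.  The elements
    [h_n^-1 h_0 ... h_m] with [m >= n] are the identity on [J_n], so they commute
    with the elements supported in [J_n] ([supported_commute]).  The centralizer
    of these is closed ([commute_cvg]), hence contains [h_n^-1 l]; and an element
    of this centralizer is the identity on [J_n], because there are elements
    supported in arbitrarily small arcs ([centralizer_fixes]).

    Now [l] is projective on some [J_n], since it has finitely many pieces.  If the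
    support of [h_n] was chosen in one half of [J_n], then [l] is the identity on
    the other half, so the projective transformation has more than two fixed
    points and is the identity ([proj_act_three]); then [h_n] is 1, a
    contradiction. *)

(* In [path], [arc] is a part of a cyclic sequence. *)
Local Notation arc := Defs.arc.

(** * Projective transformations of the line *)

Section ProjectiveTransformations.
Variable R : realType.
Implicit Types (A : SL2 R) (a b u v : @nzvec R) (p q : RP1 R) (k x y t : R).

(** A zero determinant means proportional vectors.  The factor is the orthogonal
    projection coefficient, which avoids a case analysis on the coordinates that
    vanish. *)
Lemma line_wedge0 u v : wedge2 (\val u) (\val v) = 0 -> line u = line v.
Proof.
have /set_mem : \val u \in @nzvec R by exact: valP.
have /set_mem : \val v \in @nzvec R by exact: valP.
rewrite /nzvec /wedge2 /= => v0 u0.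
set x := \val u 0 0; set y := \val u 1 0.
set x' := \val v 0 0; set y' := \val v 1 0 => /eqP; rewrite subr_eq0 => /eqP xy.
have n0 : x ^+ 2 + y ^+ 2 != 0.
  apply: contra u0; rewrite paddr_eq0 ?sqr_ge0// !sqrf_eq0 => /andP[/eqP x0 /eqP y0].
  rewrite (mkvecE (\val u)) -/x -/y x0 y0; apply/eqP/matrixP => i j.
  by rewrite !mxE; case: ifP.
(* The coefficient of the orthogonal projection of [v] on the line of [u]. *)
have vE : \val v = ((x * x' + y * y') / (x ^+ 2 + y ^+ 2)) *: \val u.
  rewrite {1}(mkvecE (\val u)) mkvec_scale (mkvecE (\val v)) -/x -/y -/x' -/y'.
  congr mkvec; apply: (mulfI n0); rewrite mulrA mulrCA divff// mulr1.
    rewrite mulrDl [in RHS]mulrDl; have -> : y * y' * x = y * (x * y') by ring.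
    by rewrite xy; ring.
  rewrite mulrDl [in RHS]mulrDl; have -> : x * x' * y = x * (y * x') by ring.
  by rewrite -xy; ring.
apply/lineP; eexists; last exact: vE.
by apply: contra v0 => /eqP k0; rewrite vE k0 scale0r.
Qed.

Lemma mulmx2_continuous (M : 'M[R]_2) : continuous (mulmx M : 'cV[R]_2 -> 'cV[R]_2).
Proof.
have -> : mulmx M = fun w : 'cV[R]_2 => w 0 0 *: col 0 M + w 1 0 *: col 1 M.
  apply/funext => w; apply/matrixP => i j; rewrite ord1 !mxE !big_ord_recl big_ord0.
  rewrite addr0 mulrC [X in _ + X]mulrC.
  by congr (_ * M _ _ + w _ _ * M _ _);
    exact: val_inj.
have cx i : continuous (fun w : 'cV[R]_2 => w i 0 : R).
  by move=> w; exact: coord_continuous.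
move=> w.
exact: (cvgD (cvgZr_tmp (a := col 0 M) (cx 0 w)) (cvgZr_tmp (a := col 1 M) (cx 1 w))).
Qed.

(** By the quotient topology it suffices to see that a linear map is continuous
    on nonzero vectors. *)
Lemma proj_act_continuous A : continuous (proj_act A).
Proof.
apply/quotient_continuous.
have -> : (proj_act A \o \pi_(RP1 R))%qT = @line R \o SL2_nzvec A.
  by apply/funext => v /=; exact: proj_act_line.
have cA : continuous (SL2_nzvec A).
  apply: continuous_comp_initial.
  have -> : set_val \o SL2_nzvec A = mulmx (\val A) \o set_val by [].
  move=> v; apply: continuous_comp; first exact: initial_continuous.
  exact: mulmx2_continuous.
move=> v; apply: continuous_comp; first exact: cA.
exact: pi_continuous.
Qed.

Lemma det_mx22 (M : 'M[R]_2) : \det M = M 0 0 * M 1 1 - M 0 1 * M 1 0.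
Proof.
rewrite (expand_det_row _ 0) !big_ord_recl big_ord0 /cofactor !det_mx11 !mxE/=.
rewrite addr0 expr0 mul1r expr1 mulN1r mulrN.
by congr (_ * M _ _ - M _ _ * M _ _); exact: val_inj.
Qed.

Lemma mulmx2E (M : 'M[R]_2) x y :
  M *m mkvec x y = mkvec (M 0 0 * x + M 0 1 * y) (M 1 0 * x + M 1 1 * y).
Proof.
apply/matrixP => i j; rewrite !mxE !big_ord_recl big_ord0 !mxE /= addr0.
have -> : lift ord0 ord0 = 1 :> 'I_2 by exact: val_inj.
case: ifP => [/eqP->//|]; case: i => -[|[|]]//= i _.
by congr (M _ _ * _ + M _ _ * _); exact: val_inj.
Qed.

Lemma wedge2_act A (v w : 'cV[R]_2) :
  wedge2 (\val A *m v) (\val A *m w) = wedge2 v w.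
Proof.
rewrite (mkvecE v) (mkvecE w) !mulmx2E !wedge2E.
set M := \val A; have /eqP := valP A; rewrite det_mx22 -/M => dA.
by rewrite -[RHS]mul1r -dA; ring.
Qed.

Lemma wedge2Z k (v w : 'cV[R]_2) : wedge2 (k *: v) w = k * wedge2 v w.
Proof. by rewrite /wedge2 !mxE; ring. Qed.

Lemma wedge2Zr k (v w : 'cV[R]_2) : wedge2 v (k *: w) = k * wedge2 v w.
Proof. by rewrite /wedge2 !mxE; ring. Qed.

(** The fixed points in the affine chart are the roots of a polynomial of degree
    at most 2; with three roots its coefficients vanish, which says that the
    matrix is scalar. *)
Lemma proj_act_three (A : SL2 R) x y t : x < y -> y < t ->
  proj_act A (affine_chart x) = affine_chart x ->
  proj_act A (affine_chart y) = affine_chart y ->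
  proj_act A (affine_chart t) = affine_chart t -> forall p, proj_act A p = p.
Proof.
set M := \val A => xy yt.
have root s : proj_act A (affine_chart s) = affine_chart s ->
    M 1 0 * s ^+ 2 + (M 1 1 - M 0 0) * s - M 0 1 = 0.
  rewrite proj_act_line => /lineP[c c0 /=]; rewrite mulmx2E mkvec_scale.
  move=> /mkvec_inj[e1 e2]; apply: (mulfI c0); rewrite mulr0.
  transitivity (s * (c * (M 1 0 * s + M 1 1 * 1)) - c * (M 0 0 * s + M 0 1 * 1)).
    by ring.
  by rewrite -e1 -e2; ring.
move=> /root e1 /root e2 /root e3.
have xy0 : x - y != 0 by rewrite subr_eq0 lt_eqF.
have yt0 : y - t != 0 by rewrite subr_eq0 lt_eqF.
have xt0 : x - t != 0 by rewrite subr_eq0 lt_eqF// (lt_trans xy).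
have f1 : M 1 0 * (x + y) + (M 1 1 - M 0 0) = 0.
  by apply: (mulfI xy0); rewrite mulr0 -[RHS](subrr 0) -{1}e1 -e2; ring.
have f2 : M 1 0 * (y + t) + (M 1 1 - M 0 0) = 0.
  by apply: (mulfI yt0); rewrite mulr0 -[RHS](subrr 0) -{1}e2 -e3; ring.
have M10 : M 1 0 = 0.
  by apply: (mulfI xt0); rewrite mulr0 -[RHS](subrr 0) -{1}f1 -f2; ring.
have M11 : M 1 1 = M 0 0.
  by apply/eqP; rewrite -subr_eq0; move: f1; rewrite M10 mul0r add0r => ->.
have M01 : M 0 1 = 0 by move: e1; rewrite M10 M11; lra.
have M0 : M 0 0 != 0.
  have /eqP := valP A; rewrite det_mx22 -/M M10 M11 mulr0 subr0 => d.
  by apply/eqP => m; move: d; rewrite m mul0r => /eqP; rewrite eq_sym oner_eq0.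
move=> p; rewrite -[p]line_repr proj_act_line; apply/esym/lineP => /=.
exists (M 0 0) => //; rewrite [\val (repr p)]mkvecE -/M mulmx2E mkvec_scale.
by rewrite M10 M11 M01 !mul0r addr0 add0r.
Qed.

End ProjectiveTransformations.

(** * Piecewise projective homeomorphisms supported in an arc *)

Section Bumps.
Variable R : realType.
Implicit Types (A B : SL2 R) (a b u v : @nzvec R) (p q : RP1 R) (k l x y t : R).

(** The eigenvalues are inverse to each other because the determinant is 1; for
    [k != 1] and [k != -1] the transformation is hyperbolic and its fixed points are
    exactly the lines of [a] and [b]. *)
Definition scales A a b k :=
  [/\ k != 0, \val A *m \val a = k *: \val a & \val A *m \val b = k^-1 *: \val b].

Lemma scales_inv A a b k : scales A a b k -> scales (SL2_inv A) a b k^-1.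
Proof.
move=> [k0 Aa Ab]; split; rewrite ?invr_eq0//=.
  rewrite -[in RHS](mulKmx (SL2_unit A) (\val a)) Aa -scalemxAr scalerA mulVf//.
  by rewrite scale1r.
rewrite -[in RHS](mulKmx (SL2_unit A) (\val b)) Ab -scalemxAr scalerA invrK.
by rewrite mulfV// scale1r.
Qed.

Lemma wedge2_eigen A k (c w : 'cV[R]_2) :
  \val A *m c = k *: c -> k * wedge2 c (\val A *m w) = wedge2 c w.
Proof. by move=> Ac; rewrite -wedge2Z -Ac wedge2_act. Qed.

(** [A] preserves [wedge2] and rescales [a] and [b] by inverse factors, so it
    preserves the quadratic form [arc_form a b] itself, hence its sign. *)
Lemma arc_act A a b k s p : scales A a b k ->
  arc s (\val a) (\val b) (proj_act A p) = arc s (\val a) (\val b) p.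
Proof.
move=> [k0 Aa Ab]; rewrite -[p]line_repr proj_act_line !arcE /=.
rewrite /arc_form -(wedge2_eigen (\val (repr p)) Aa) -(wedge2_eigen (\val (repr p)) Ab).
by rewrite mulrACA mulfV// mul1r.
Qed.

Lemma proj_act_scales A a b k : scales A a b k ->
  proj_act A (line a) = line a /\ proj_act A (line b) = line b.
Proof.
move=> [k0 Aa Ab]; rewrite !proj_act_line; split; apply/esym/lineP => /=.
  by exists k.
by exists k^-1 => //; rewrite invr_eq0.
Qed.

Lemma arc_cases a b p : [\/ arc true (\val a) (\val b) p,
  arc false (\val a) (\val b) p, p = line a | p = line b].
Proof.
rewrite -[p]line_repr; set v := repr p; rewrite !arcE expr1 expr0 mul1r mulN1r.
rewrite oppr_gt0; case: (ltgtP (arc_form (\val a) (\val b) (\val v)) 0).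
- by constructor 1.
- by constructor 2.
- move=> /eqP; rewrite mulf_eq0 => /orP[] /eqP/line_wedge0 <-.
    by constructor 3.
  by constructor 4.
Qed.

Lemma arc_true_false a b p : arc true (\val a) (\val b) p ->
  ~ arc false (\val a) (\val b) p.
Proof.
rewrite /arc /= expr1 expr0 mul1r mulN1r oppr_gt0 => h h'.
by have := lt_trans h h'; rewrite ltxx.
Qed.

Lemma arc_ends s a b : ~ arc s (\val a) (\val b) (line a) /\
  ~ arc s (\val a) (\val b) (line b).
Proof.
have w0 (c : 'cV[R]_2) : wedge2 c c = 0 by rewrite /wedge2; ring.
by rewrite !arcE /arc_form !w0 mul0r !mulr0 ltxx.
Qed.

(** The two pieces agree at the ends of the arc, which are fixed points of [A]:
    cutting off a hyperbolic transformation in this way is the source of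
    piecewise projective homeomorphisms with small support. *)
Definition arc_bump A a b p : RP1 R :=
  if `[< arc true (\val a) (\val b) p >] then proj_act A p else p.

Lemma arc_bump_in A a b p : arc true (\val a) (\val b) p -> arc_bump A a b p = proj_act A p.
Proof. by rewrite /arc_bump => h; rewrite asboolT. Qed.

Lemma arc_bump_out A a b p : ~ arc true (\val a) (\val b) p -> arc_bump A a b p = p.
Proof. by rewrite /arc_bump => h; rewrite asboolF. Qed.

Lemma arc_bumpK A a b k : scales A a b k -> cancel (arc_bump A a b) (arc_bump (SL2_inv A) a b).
Proof.
move=> sA p; have [h|h] := pselect (arc true (\val a) (\val b) p).
  by rewrite (arc_bump_in _ h) arc_bump_in ?proj_actK// (arc_act _ _ sA).
by rewrite (arc_bump_out _ h) arc_bump_out.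
Qed.

(** The complements of the two open arcs with ends [a] and [b] are closed and cover
    the circle; [arc_bump A a b] is the identity on the first one and [A] on the
    second one. *)
Lemma arc_bump_continuous A a b k : scales A a b k -> continuous (arc_bump A a b).
Proof.
move=> sA; have [fa fb] := proj_act_scales sA.
have /(continuous_subspaceT (A := ~` arc true (\val a) (\val b))) c1 :
  continuous (@id (RP1 R)) by move=> p; exact: cvg_id.
have /(continuous_subspaceT (A := ~` arc false (\val a) (\val b))) c2 :=
  proj_act_continuous (A := A).
have e1 : {in ~` arc true (\val a) (\val b), id =1 arc_bump A a b}.
  by move=> p /set_mem h; rewrite arc_bump_out.
have e2 : {in ~` arc false (\val a) (\val b), proj_act A =1 arc_bump A a b}.
  move=> p /set_mem h; case: (arc_cases a b p) => // [h'|->|->].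
  - by rewrite arc_bump_in.
  - by rewrite arc_bump_out//; have [] := arc_ends true a b.
  - by rewrite arc_bump_out//; have [] := arc_ends true a b.
have := withinU_continuous (open_closedC (arc_open true (\val a) (\val b)))
  (open_closedC (arc_open false (\val a) (\val b)))
  (subspace_eq_continuous e1 c1) (subspace_eq_continuous e2 c2).
have -> : ~` arc true (\val a) (\val b) `|` ~` arc false (\val a) (\val b) = setT.
  apply/seteqP; split => // p _.
  have [h|h] := pselect (arc true (\val a) (\val b) p); last by left.
  by right; exact: arc_true_false.
by rewrite -continuous_subspace_setT.
Qed.

(** A connected set that avoids both ends lies in one of the two arcs. *)
Lemma arc_bump_pp A a b : piecewise_projective (arc_bump A a b).
Proof.
apply/piecewise_projectiveP; exists [set line a; line b].
  by rewrite finite_setU; split; exact: finite_set1.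
move=> C cC Cab.
have Ca : ~ C (line a).
  by move=> h; suff : set0 (line a) by []; rewrite -Cab; split => //; left.
have Cb : ~ C (line b).
  by move=> h; suff : set0 (line b) by []; rewrite -Cab; split => //; right.
have [[p Cp hp]|h] := pselect (exists2 p, C p & arc true (\val a) (\val b) p);
  last first.
  exists (SL2_1 R) => p /set_mem Cp; rewrite proj_act1 arc_bump_out// => hp.
  by apply: h; exists p.
exists A => q /set_mem Cq.
case: (arc_cases a b q) => [h|h|h|h]; last 2 first.
- by case: Ca; rewrite -h.
- by case: Cb; rewrite -h.
- by rewrite arc_bump_in.
exfalso; move: h hp Cq Cp; rewrite -[p]line_repr -[q]line_repr !arcE.
rewrite expr0 expr1 mul1r mulN1r oppr_gt0 => h hp Cq Cp.
exact: (connected_arc cC Ca Cb Cq Cp h hp).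
Qed.

Lemma arc_bump_homeo A a b k : scales A a b k -> homeomorphism (arc_bump A a b).
Proof.
move=> sA; have sV := scales_inv sA.
split; first exact: arc_bump_continuous sA.
exists (arc_bump (SL2_inv A) a b); last exact: arc_bump_continuous sV.
split; first exact: arc_bumpK sA.
have -> : arc_bump A a b = arc_bump (SL2_inv (SL2_inv A)) a b.
  congr arc_bump; apply: val_inj => /=; rewrite invmxK.
  by [].
exact: arc_bumpK sV.
Qed.

Definition pp_arc_bump A a b k (sA : scales A a b k) : PPHomeo R :=
  MkPPHomeo (arc_bump_homeo sA) (arc_bump_pp A a b).

(** The transformations with given fixed points [a] and [b] form a one-parameter
    group, parametrised by the square of the eigenvalue at [a], and this group acts
    freely on the arcs between [a] and [b].  For [B] the identity this says that [A]
    moves every point of the arc. *)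
Lemma proj_act_eq_scales A B a b k l p : scales A a b k -> scales B a b l ->
  arc true (\val a) (\val b) p -> proj_act A p = proj_act B p -> k ^+ 2 = l ^+ 2.
Proof.
move=> [k0 Aa Ab] [l0 Ba Bb]; rewrite -[p]line_repr; set v := repr p.
rewrite arcE expr1 mulN1r oppr_gt0 => /ltr0_neq0; rewrite mulf_eq0 negb_or.
move=> /andP[av bv]; rewrite !proj_act_line => /lineP[c c0 /= E].
have ea : k = l * c.
  apply: (mulIf av); rewrite -{1}(wedge2_eigen (\val v) Ba) E wedge2Zr.
  by rewrite -(wedge2_eigen (\val v) Aa); ring.
have eb : k^-1 = l^-1 * c.
  apply: (mulIf bv); rewrite -{1}(wedge2_eigen (\val v) Bb) E wedge2Zr.
  by rewrite -(wedge2_eigen (\val v) Ab); ring.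
move: eb; rewrite ea invfM => /(congr1 (fun z => z * (l * c * l))).
have -> : l^-1 / c * (l * c * l) = l by field; rewrite ?c0 ?l0.
have -> : l^-1 * c * (l * c * l) = c ^+ 2 * l by field.
move=> e; have {e} : c ^+ 2 = 1 by apply: (mulIf l0); rewrite mul1r.
by rewrite exprMn => ->; rewrite mulr1.
Qed.

Lemma scales1 a b : scales (SL2_1 R) a b 1.
Proof. by split; rewrite ?oner_neq0// ?invr1 scale1r mul1mx. Qed.

Lemma arc_bump_fixed A a b k p : scales A a b k -> 1 < k ->
  arc_bump A a b p = p -> ~ arc true (\val a) (\val b) p.
Proof.
move=> sA k1 + h; rewrite arc_bump_in// -{2}[p]proj_act1.
by move=> /(proj_act_eq_scales sA (scales1 a b) h); nra.
Qed.

(** The matrix is the one of the endomorphism with eigenvectors [(x, 1)] and [(y, 1)]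
    and eigenvalues [k] and [k^-1], written in the standard basis. *)
Lemma scales_exists x y k : x != y -> k != 0 ->
  exists A, scales A (affine_vec x) (affine_vec y) k.
Proof.
move=> xy k0; have d0 : x - y != 0 by rewrite subr_eq0.
pose M : 'M[R]_2 := \matrix_(i, j)
  if i == 0 then (if j == 0 then (k * x - k^-1 * y) / (x - y)
                  else (k^-1 - k) * x * y / (x - y))
  else (if j == 0 then (k - k^-1) / (x - y) else (k^-1 * x - k * y) / (x - y)).
have dM : \det M == 1 by rewrite det_mx22 !mxE /=; apply/eqP; field; rewrite ?k0 ?d0.
exists (exist (fun A : 'M[R]_2 => \det A == 1) M dM); split => //=;
  by rewrite mulmx2E mkvec_scale !mxE /=; congr mkvec; field; rewrite ?k0 ?d0.
Qed.

Lemma arc_affineP x y t : x < y ->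
  arc true (mkvec x 1) (mkvec y 1) (affine_chart t) <-> x < t < y.
Proof.
move=> xy; rewrite arcE expr1 mulN1r oppr_gt0 /arc_form /= !wedge2E.
split=> [h|/andP[]]; last by nra.
by apply/andP; split; rewrite ltNge; apply/negP => ?; nra.
Qed.

Lemma arc_affine_infty x y : ~ arc true (mkvec x 1) (mkvec y 1) (infty R).
Proof.
rewrite arcE expr1 mulN1r oppr_gt0 /arc_form /= !wedge2E !mulr0 !mulr1 !sub0r.
by rewrite mulrNN mulr1 ltr10.
Qed.

Definition oarc x y : set (RP1 R) := @affine_chart R @` [set t | x < t < y].

Lemma oarcE x y : x < y -> oarc x y = arc true (mkvec x 1) (mkvec y 1).
Proof.
move=> xy; apply/seteqP; split => [_ [t /(arc_affineP _ xy) h <-]//|p].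
have [->|[t ->]] := RP1_cases p; first by move/arc_affine_infty.
by move=> /(arc_affineP _ xy) h; exists t.
Qed.

(** The bounds on the parameter make its square injective and exclude the
    identity. *)
Lemma arc_bump_family x y : x < y -> exists f : R -> PPHomeo R,
  (forall k p, 1 < k -> f k p = p <-> ~ oarc x y p) /\
  {in [set k | 1 < k] &, injective f}.
Proof.
move=> xy; have xNy : x != y by rewrite lt_eqF.
have ex k : exists f : PPHomeo R, 1 < k ->
    exists2 A, scales A (affine_vec x) (affine_vec y) k &
      f =1 arc_bump A (affine_vec x) (affine_vec y).
  have [k1|k1] := ltP 1 k; last by exists 1%g.
  have k0 : k != 0 by rewrite gt_eqF// (lt_trans ltr01).
  have [A sA] := scales_exists xNy k0.
  by exists (pp_arc_bump sA) => _; exists A.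
have [f fP] := choice ex; exists f; split.
  move=> k p k1; have [A sA ->] := fP k k1; rewrite oarcE//; split.
    exact: arc_bump_fixed sA k1.
  by move=> h; rewrite arc_bump_out.
move=> k l /set_mem k1 /set_mem l1 fkl; rewrite /= in k1 l1.
have [A sA fA] := fP k k1; have [B sB fB] := fP l l1.
have h : arc true (\val (affine_vec x)) (\val (affine_vec y)) (affine_chart ((x + y) / 2)).
  by apply/arc_affineP => //; apply/andP; split; lra.
have : proj_act A (affine_chart ((x + y) / 2)) = proj_act B (affine_chart ((x + y) / 2)).
  by rewrite -(arc_bump_in A h) -(arc_bump_in B h) -fA -fB fkl.
by move=> /(proj_act_eq_scales sA sB h) ?; nra.
Qed.

End Bumps.

(** * Separable and completely metrizable groups *)

Section PolishGroups.
Variables (R : realType) (G : groupType) (tau : topology_on G).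
Local Notation T := (with_topology tau).
Hypothesis tau_group : group_topology tau.

Lemma group_topology_mul (I : Type) (F : set_system I) (f g : I -> T) (a b : T) : Filter F ->
  f x @[x --> F] --> a -> g x @[x --> F] --> b ->
  (f x * g x)%g @[x --> F] --> (a * b)%g.
Proof.
move=> FF fa gb.
exact: (@continuous2_cvg I T T T F _ f g (fun x y => x * y)%g a b (tau_group.1 (a, b)) fa gb).
Qed.

Lemma left_translation_continuous (a : T) : continuous (fun x : T => (a * x)%g).
Proof.
move=> x; apply: (@group_topology_mul T (nbhs x) (fun=> a) id); last exact: cvg_id.
exact: cvg_cst.
Qed.

(** In a separable group an uncountable set is not uniformly discrete: otherwise
    the translates of a small neighbourhood of 1 by its elements would be
    disjoint, and each of them contains a point of the countable dense set. *)
Lemma close_pair (f : R -> T) (S : set R) (U : set T) : separable T ->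
  ~ countable S -> {in S &, injective f} -> nbhs (1%g : T) U ->
  exists x y : R, [/\ S x, S y, x != y & U ((f x)^-1 * f y)%g].
Proof.
move=> [A cA dA] uS injf U1; apply: contrapT => noU.
have : (fun p : T * T => (p.1 * p.2^-1)%g) @ nbhs ((1, 1) : T * T)%g --> (1%g : T).
  rewrite -[X in _ --> X](mulg1 (1%g : T)) -[X in (_ * X)%g]invg1.
  apply: group_topology_mul; first exact: cvg_fst.
  by apply: cvg_comp; [exact: cvg_snd|exact: tau_group.2].
move=> /(_ _ U1) [[V W] /= [V1 W1] VWU].
have ex x : exists a : T, A a /\ (V `&` W) ((f x)^-1 * a)%g.
  have Bx : nbhs (f x) [set a : T | (V `&` W) ((f x)^-1 * a)%g].
    have := @left_translation_continuous (f x)^-1%g (f x).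
    by rewrite /continuous_at mulVg; apply; exact: filterI.
  have [|a [aB Aa]] := dA _ _ (open_interior [set a : T | (V `&` W) ((f x)^-1 * a)%g]).
    by exists (f x); exact: Bx.
  by exists a; split=> //; exact: (interior_subset aB).
have [c cP] := choice ex.
have /countable_injP[i injA] := cA.
apply: uS; apply/countable_injP; exists (i \o c) => x y xS yS /= ixy.
have {}ixy : c x = c y.
  by apply: injA ixy; apply/mem_set; have [] := cP x; have [] := cP y.
have [//|xy] := eqVneq x y; exfalso; apply: noU.
exists x, y; split; [exact/set_mem|exact/set_mem|exact: xy|].
have [[_ [Vx _]] [_ [_ Wy]]] := (cP x, cP y).
have := VWU (_, _) (conj Vx Wy); rewrite /= -ixy mulgKA invgK; exact.
Qed.

(** Each factor may depend on the product of the previous ones: how small it has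
    to be is only known once that product is fixed. *)
Fixpoint partial_product (H : nat -> G -> G) n : G :=
  if n is m.+1 then (partial_product H m * H m (partial_product H m))%g else 1%g.

(** Summing the steps [2^-(n+1) + 2^-(n+2) + ...] gives at most [2^-n].  The induction
    is on the number of steps, for all starting points at once, so that the bound
    does not depend on this number. *)
Lemma ball_geometric (M : pseudoMetricType R) (x : nat -> M) :
  (forall n, ball (x n) (2^-1 ^+ n.+1) (x n.+1)) ->
  forall n m, (n <= m)%N -> ball (x n) (2^-1 ^+ n) (x m).
Proof.
move=> xP n m /subnKC <-; move: (m - n)%N => k; elim: k n => [|k IHk] n.
  by rewrite addn0; apply: ballxx; rewrite exprn_gt0// invr_gt0.
have -> : 2^-1 ^+ n = 2^-1 ^+ n.+1 + 2^-1 ^+ n.+1 :> R by rewrite exprS; field.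
by apply: ball_triangle (xP n) _; rewrite addnS -addSn.
Qed.

(** Multiplying by an element close enough to 1 moves the partial product by less
    than a prescribed distance, for a complete metric that defines the topology.
    Thus the factors can be chosen so that the partial products form a Cauchy
    sequence. *)
Lemma convergent_product (P : nat -> G -> Prop) : completely_metrizable R T ->
  (forall n (U : set T), nbhs (1%g : T) U -> exists2 h, P n h & U h) ->
  exists (h g : nat -> T) (l : T), [/\ forall n, P n (h n), g 0%N = 1%g,
    forall n, g n.+1 = (g n * h n)%g & g @ \oo --> l].
Proof.
move=> [M [phi [phic [psi [phiK psiK] psic]]]] PU.
have ex (ng : nat * T) : exists h, P ng.1 h /\
    ball (phi ng.2) (2^-1 ^+ ng.1.+1) (phi (ng.2 * h)%g).
  have [|h ? ?] := PU ng.1 [set h : T | ball (phi ng.2) (2^-1 ^+ ng.1.+1) (phi (ng.2 * h)%g)].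
  - have : phi (ng.2 * h)%g @[h --> (1%g : T)] --> phi (ng.2 * 1)%g.
      apply: (@continuous_comp T T M (fun h => (ng.2 * h)%g) phi (1%g : T)).
        exact: left_translation_continuous.
      exact: phic.
    rewrite mulg1.
    by apply; apply: nbhsx_ballx; rewrite exprn_gt0// invr_gt0.
  - by exists h.
have [H HP] := choice ex.
pose g := partial_product (fun n x => H (n, x)).
pose h n := H (n, g n).
have cg : cauchy (phi \o g @ \oo).
  apply: cauchy_exP => e e0.
  have [n ne] : exists n, 2^-1 ^+ n < e.
    have z1 : `|2^-1 : R| < 1 by rewrite ger0_norm ?invr_ge0// invf_lt1// ltr1n.
    have /cvgr0_norm_lt/(_ _ e0)/filter_ex[n] := cvg_expr z1.
    by rewrite ger0_norm ?exprn_ge0 ?invr_ge0// => ?; exists n.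
  exists (phi (g n)); exists n => // m /= nm.
  apply: le_ball (ltW ne) _ _.
  apply: (ball_geometric (x := phi \o g)) nm => k /=.
  exact: (HP (k, g k)).2.
have /cvg_ex[l lP] : cvg (phi \o g @ \oo) by exact: cauchy_cvg.
exists h, g, (psi l); split => //; first by move=> n; exact: (HP (n, g n)).1.
have -> : g = psi \o (phi \o g) by apply/funext => n /=; rewrite phiK.
by apply: continuous_cvg => //; exact: psic.
Qed.

Lemma completely_metrizable_hausdorff : completely_metrizable R T -> hausdorff_space T.
Proof.
move=> [M [phi [phic [psi [phiK psiK] psic]]]] x y xy.
apply: (can_inj phiK); apply: (@metric_hausdorff R M) => A B Ax By.
have [z [Az Bz]] := xy _ _ (phic _ _ Ax) (phic _ _ By).
by exists (phi z).
Qed.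

(** Centralizers are closed in a Hausdorff group. *)
Lemma commute_cvg (I : Type) (F : set_system I) (u : I -> T) (f a : T) :
  hausdorff_space T -> ProperFilter F -> u x @[x --> F] --> a ->
  (\forall i \near F, (f * u i = u i * f)%g) -> (f * a = a * f)%g.
Proof.
move=> hT FF ua fu.
have fl : (f * u x)%g @[x --> F] --> (f * a)%g.
  by apply: (@group_topology_mul I F (fun=> f) u) ua; exact: cvg_cst.
have fr : (u x * f)%g @[x --> F] --> (a * f)%g.
  by apply: (@group_topology_mul I F u (fun=> f)) => //; exact: cvg_cst.
apply: (cvg_unique hT fl); apply: cvg_trans fr.
by apply: near_eq_cvg; apply: filterS fu => i ->.
Qed.

End PolishGroups.

(** * Supports and centralizers *)

Section Supports.
Variable R : realType.
Implicit Types (f g h k : PPHomeo R) (J : set (RP1 R)) (p q : RP1 R) (x y t : R).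

Definition supported f J := forall p, ~ J p -> f p = p.

Lemma pphomeo_inj f : injective f.
Proof. exact: can_inj (pphomeo_funK f). Qed.

Lemma supported_stable f J p : supported f J -> J p -> J (f p).
Proof.
move=> fJ Jp; apply: contrapT => Jfp.
by have /pphomeo_inj fp := fJ _ Jfp; apply: Jfp; rewrite fp.
Qed.

(** Both [J] and its
    complement are stable under [f] and [k]. *)
Lemma supported_commute f k J : supported f J -> (forall p, J p -> k p = p) ->
  (f * k = k * f)%g.
Proof.
move=> fJ kJ; apply: PPHomeo_eq => p; change (f (k p) = k (f p)).
have [Jp|Jp] := pselect (J p).
  by rewrite [k p]kJ// [RHS]kJ//; exact: supported_stable.
rewrite [f p]fJ// fJ// => Jkp; apply: Jp.
by have /pphomeo_inj kp := kJ _ Jkp; rewrite -kp.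
Qed.

Lemma oarc_chart x y t : oarc x y (affine_chart t) <-> x < t < y.
Proof.
split; last by exists t.
by move=> [s h /affine_chart_inj <-].
Qed.

Lemma oarc_infty x y : ~ oarc x y (infty R).
Proof. by move=> [t _ /affine_chart_neq_infty]. Qed.

(** The arc can be shortened on the side where [q] lies. *)
Lemma oarc_separate x y t q : x < t < y -> q <> affine_chart t ->
  exists x' y', [/\ x <= x', x' < t < y', y' <= y & ~ oarc x' y' q].
Proof.
move=> /andP[xt ty]; have [->|[s ->]] := RP1_cases q.
  by exists x, y; split; rewrite ?xt ?ty ?lexx//; exact: oarc_infty.
move=> st; have {st} : s != t by apply: contra_notN st => /eqP->.
rewrite neq_lt => /orP[st|ts].
  exists (Num.max x s), y; rewrite le_max lexx gt_max xt st ty lexx; split => //.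
  by move=> /oarc_chart; rewrite gt_max ltxx andbF.
exists x, (Num.min y s); rewrite ge_min lexx lt_min xt ts ty lexx; split => //.
by move=> /oarc_chart; rewrite lt_min ltxx !andbF.
Qed.

(** Being the identity on an arc follows from an algebraic condition, which is what
    makes it pass to limits in an arbitrary Hausdorff group topology.  If [k] moves a
    point [p] of the arc, then some smaller arc contains [p] and misses [k p]; an [f]
    whose moved points are exactly those of the smaller arc moves [p] and fixes
    [k p], so it does not commute with [k]. *)
Lemma centralizer_fixes k x y : (forall f, supported f (oarc x y) -> (f * k = k * f)%g) ->
  forall p, oarc x y p -> k p = p.
Proof.
move=> kC _ [t xty <-]; apply: contrapT => kt.
have [x' [y' [xx' x'ty' y'y qx'y']]] := oarc_separate xty kt.
have /andP[x't ty'] := x'ty'.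
have [F [FP _]] := arc_bump_family (lt_trans x't ty').
have l2 : (1 : R) < 2 by rewrite ltr1n.
have /kC fk : supported (F 2) (oarc x y).
  move=> p pxy; apply/FP => // -[s /andP[x's sy'] ps]; apply: pxy.
  by exists s => //; apply/andP; split; [exact: le_lt_trans x's|exact: lt_le_trans y'y].
have : F 2 (affine_chart t) = affine_chart t; last first.
  by move/(FP _ _ l2); apply; exists t.
apply: (@pphomeo_inj k).
have /= <- := congr1 (fun f : PPHomeo R => f (affine_chart t)) fk.
exact/(FP _ _ l2).
Qed.

Lemma uncountable_ray : ~ countable [set k : R | 1 < k].
Proof.
move=> /countable_lebesgue_measure0.
have -> : [set k : R | 1 < k] = [set` `]1, +oo[%R].
  by apply/seteqP; split => k /=; rewrite in_itv/= andbT.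
by rewrite lebesgue_measure_itv /= ltry.
Qed.

End Supports.

(** * An infinite product with infinitely many pieces *)

Theorem corollary1p3 (R : realType) :
  ~ exists tau : topology_on (PPHomeo R), polish_group_topology R tau.
Proof.
move=> [tau [tauG sep cmp]].
pose T := with_topology tau.
(* The factors live on the right halves of disjoint cells that accumulate at
   infinity; all the factors are the identity on the left halves, and so will be
   the limit. *)
pose core n : set (RP1 R) := oarc (n%:R + 2^-1) (n.+1%:R).
pose cell n : set (RP1 R) := oarc n%:R n.+1%:R.
have core_cell n : core n `<=` cell n.
  move=> _ [t /andP[nt tn] <-]; exists t => //; apply/andP; split=> //.
  by apply: lt_trans nt; rewrite ltrDl invr_gt0.
pose P n (h : PPHomeo R) := h <> 1%g /\ supported h (core n).
have small n (U : set T) : nbhs (1%g : T) U -> exists2 h, P n h & U h.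
  move=> U1; have nn : n%:R + 2^-1 < n.+1%:R :> R.
    by rewrite -(natr1 n) ltrD2l invf_lt1// ltr1n.
  have [f [fP finj]] := arc_bump_family nn.
  have [x [y [x1 y1 xy Uxy]]] :=
    close_pair tauG (f := f) sep (@uncountable_ray R) finj U1.
  exists ((f x)^-1 * f y)%g => //; split.
    move=> fxy; move/eqP: xy; apply; apply: finj; [exact/mem_set|exact/mem_set|].
    by rewrite -[RHS](mulKg (f x)^-1%g) invgK fxy mulg1.
  move=> p np; change (pphomeo_inv (f x) (f y p) = p).
  have /(fP _ _ y1) -> := np; have /(fP _ _ x1) fxp := np.
  by rewrite -{1}fxp pphomeo_funK.
have [h [g [l [hP g0 gS gl]]]] := convergent_product tauG cmp small.
have disj m n p : core m p -> cell n p -> m = n.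
  move=> /core_cell[t /andP[mt tm] <-] /oarc_chart/andP[nt tn].
  have := lt_trans mt tn; have := lt_trans nt tm; rewrite !ltr_nat !ltnS => nm mn.
  by apply/eqP; rewrite eqn_leq mn nm.
have h_cell m n p : m != n -> cell n p -> (h m : PPHomeo R) p = p.
  by move=> mn np; apply: (hP m).2 => mp; rewrite (disj m n p) ?eqxx in mn.
(* At each point of the cell [n] only the factor [h n] acts, so the sequence [g] is
   stationary there from [n + 1] on. *)
have g_before n p m : cell n p -> (m <= n)%N -> (g m : PPHomeo R) p = p.
  move=> np; elim: m => [|m IHm] mn; first by rewrite g0.
  rewrite gS; change ((g m : PPHomeo R) ((h m : PPHomeo R) p) = p).
  by rewrite (h_cell m n)// ?IHm 1?ltnW// neq_ltn mn.
have g_after n p m : cell n p -> (n < m)%N ->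
    (g m : PPHomeo R) p = (h n : PPHomeo R) p.
  move=> np; elim: m => // m IHm; rewrite ltnS leq_eqVlt gS => nm.
  change ((g m : PPHomeo R) ((h m : PPHomeo R) p) = (h n : PPHomeo R) p).
  case/orP: nm => [/eqP <-|nm].
    rewrite (g_before n)//; apply: supported_stable np => q nq.
    by apply: (hP n).2 => /core_cell.
  by rewrite (h_cell m n) ?IHm// neq_ltn nm orbT.
(* Nothing is assumed about convergence at points of the circle: the equality
   reaches the limit through commutation with the elements supported in the cell. *)
have l_cell n p : cell n p -> (l : PPHomeo R) p = (h n : PPHomeo R) p.
  move=> np; pose k : PPHomeo R := ((h n : PPHomeo R)^-1 * l)%g.
  have kp : k p = p.
    apply: centralizer_fixes np => f fn.
    apply: (commute_cvg tauG (F := \oo) (u := fun m => ((h n : T)^-1 * g m)%g)).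
    - exact: completely_metrizable_hausdorff cmp.
    - apply: (@group_topology_mul _ tau tauG _ _ (fun=> (h n : T)^-1%g) g) => //.
      exact: cvg_cst.
    exists n.+1 => // m nm; apply: supported_commute fn _ => q nq.
    change (pphomeo_inv (h n) ((g m : PPHomeo R) q) = q).
    by rewrite (g_after n)// pphomeo_funK.
  rewrite -{2}kp.
  change ((l : PPHomeo R) p =
    (h n : PPHomeo R) (pphomeo_inv (h n) ((l : PPHomeo R) p))).
  by rewrite pphomeo_invK.
have /piecewise_projectiveP[F fF hF] := pphomeo_pp (l : PPHomeo R).
(* Only finitely many cells contain a break of the limit. *)
have [n nF] : exists n, cell n `&` F = set0.
  have /finite_seqP[s sE] : finite_set (@affine_chart R @^-1` F).
    by apply: finite_preimage => // x y _ _; exact: affine_chart_inj.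
  have [n sn] : exists n, forall t, t \in s -> t < n%:R.
    elim: s {sE} => [|t s [n sn]]; first by exists 0%N.
    exists (maxn n (Num.bound `|t|)) => u; rewrite inE => /orP[/eqP->|/sn un].
      apply: le_lt_trans (ler_norm t) _; apply: lt_le_trans (archi_boundP _) _ => //.
      by rewrite ler_nat leq_maxr.
    by apply: lt_le_trans un _; rewrite ler_nat leq_maxl.
  exists n; apply/seteqP; split => // _ [[t /andP[nt _] <-] Ft].
  have : [set` s] t by rewrite -sE.
  by move=> /= /sn; rewrite ltNge ltW.
have [A lA] : exists A : SL2 R, {in cell n, forall p, (l : PPHomeo R) p = proj_act A p}.
  apply: hF nF; apply: connected_continuous_connected; last first.
    by apply: continuous_subspaceT; exact: affine_chart_continuous.
  by apply/connected_intervalP => x y /= hx hy z hz; lra.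
have fixA t : n%:R < t < n%:R + 2^-1 ->
    proj_act A (affine_chart t) = affine_chart t.
  move=> /andP[nt tn].
  have tcell : cell n (affine_chart t).
    apply/oarc_chart; rewrite nt (lt_trans tn)// -(natr1 n) ltrD2l.
    by rewrite invf_lt1// ltr1n.
  rewrite -lA; last exact/mem_set.
  by rewrite (l_cell n)//; apply: (hP n).2 => /oarc_chart; rewrite ltNge ltW.
(* Any three points of the left half of the cell. *)
have A1 : forall p, proj_act A p = p.
  apply: (@proj_act_three R A (n%:R + 8^-1) (n%:R + 4^-1) (n%:R + 3 / 8));
    first [by apply: fixA; apply/andP; split; lra|by lra].
apply: (hP n).1; apply: PPHomeo_eq => p.
have [/core_cell pn|pn] := pselect (core n p); last exact: (hP n).2.
by rewrite -(l_cell n)// lA ?A1//; exact/mem_set.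
Qed.
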